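(* Let $\beta>0$. Let $G$ be a bipartite graph with bipartition $(U,W)$ such that $|W|\ge |U|$, let $n=|U|+|W|$, and suppose $G$ has no isolated vertices. If $G$ is an $(n,\beta)$-graph, then $$\alpha'(G)\ge \min\left\{1/\beta^{2},\,1\right\}\cdot |U|.$$
   Context: All graphs are finite, simple and nonempty. $\alpha'(G)$ denotes the matching number. For vertex sets $X,Y$, $e(X,Y)$ is the number of edges with one end in $X$ and the other in $Y$ (edges with both ends in $X\cap Y$ counted twice). For $\beta>0$, a graph $G$ on $n$ vertices is an $(n,\beta)$-graph if $\frac{|X||Y|}{(n-|X|)(n-|Y|)}\le\beta^2$ for every pair of (not necessarily disjoint) proper subsets $X,Y$ of $V(G)$ with $e(X,Y)=0$. By convention $K_n$ is an $(n,\beta)$-graph for every $\beta>0$. *)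

(* Defs.v *)
From HB Require Import structures.
From mathcomp Require Import all_boot all_order all_algebra.
From mathcomp Require Import reals.

Set Implicit Arguments.
Unset Strict Implicit.
Unset Printing Implicit Defensive.

Import Order.TTheory GRing.Theory Num.Theory.
Local Open Scope ring_scope.

Record sgraph := SGraph {
  vertex :> finType;
  adj : rel vertex;
  adj_sym : symmetric adj;
  adj_irr : irreflexive adj;
  vertex_gt0 : (0 < #|vertex|)%N
}.

Section GraphDefs.
Variable G : sgraph.

Definition edges : {set {set G}} :=
  [set [set p.1; p.2] | p : G * G & adj p.1 p.2].

Definition matching (M : {set {set G}}) : bool :=
  (M \subset edges) && trivIset M.

Definition matching_number : nat :=
  \max_(M : {set {set G}} | matching M) #|M|.

(* Counting ordered pairs counts an edge with both ends in X :&: Y twice and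
   every other edge between X and Y once. *)
Definition num_edges (X Y : {set G}) : nat :=
  #|[set p : G * G | [&& p.1 \in X, p.2 \in Y & adj p.1 p.2]]|.

Definition complete : Prop := forall x y : G, x != y -> adj x y.

Definition isolated (x : G) : Prop := forall y : G, ~~ adj x y.

Definition bipartition (U W : {set G}) : Prop :=
  [/\ U :|: W = [set: G], [disjoint U & W] &
      forall x y : G, adj x y ->
        (x \in U) && (y \in W) || (x \in W) && (y \in U)].

(* Complete graphs are admitted by convention: for n > 1 the ratio condition
   alone can fail on K_n, with X = Y a single vertex. *)
Definition nbeta_graph (R : realType) (n : nat) (beta : R) : Prop :=
  #|G| = n /\
  (complete \/
   forall X Y : {set G},
     X \proper [set: G] -> Y \proper [set: G] -> num_edges X Y = 0%N ->
     (#|X|%:R * #|Y|%:R) / ((n%:R - #|X|%:R) * (n%:R - #|Y|%:R))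
       <= beta ^+ 2).

End GraphDefs.

(* Main.v *)
(** Koenig's theorem in deficiency form gives [S] inside [U], with
    neighbourhood [T], such that [|U| - |S| + |T| <= alpha'(G)].  If
    [|T| < |S|], there is no edge between [S] and the complement of [T], so
    [1/beta^2 <= |T|(n-|S|) / (|S|(n-|T|)) <= |T|/|S|], and
    [|U||T|/|S| <= |U| - |S| + |T|] because [|S| <= |U|]. *)
Require Import Defs.
From HB Require Import structures.
From mathcomp Require Import all_boot all_order all_algebra.
From mathcomp Require Import reals.
From mathcomp Require Import zify lra.

Set Implicit Arguments.
Unset Strict Implicit.
Unset Printing Implicit Defensive.

Import Order.TTheory GRing.Theory Num.Theory.
Local Open Scope ring_scope.

Section Koenig.
Local Open Scope nat_scope.
Variables T1 T2 : finType.
Implicit Types (E : {set T1 * T2}) (S U : {set T1}).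

(** The bipartite graph is a bare set of pairs, so that its edges can be deleted one at a time. *)
Definition nbhd E S : {set T2} := [set w | [exists u in S, (u, w) \in E]].

Lemma nbhdP E S w : reflect (exists2 u, u \in S & (u, w) \in E) (w \in nbhd E S).
Proof. by rewrite inE; apply: exists_inP. Qed.

(** Submodularity of the neighbourhood. The union loses nothing, since [u] still reaches [w1]
    through [S2] and [w2] through [S1]. Points of [S1 :&: S2] other than [u] keep all their edges,
    so their neighbours lie in both sets. *)
Lemma nbhd_uncross E u w1 w2 S1 S2 : w1 != w2 ->
    (u, w1) \in E -> (u, w2) \in E -> u \in S1 -> u \in S2 ->
  #|nbhd E (S1 :|: S2)| + #|nbhd E ((S1 :&: S2) :\ u)|
    <= #|nbhd (E :\ (u, w1)) S1| + #|nbhd (E :\ (u, w2)) S2|.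
Proof.
move=> w12 Ew1 Ew2 uS1 uS2.
rewrite -(cardsUI (nbhd (E :\ _) S1)); apply: leq_add; apply: subset_leq_card.
  apply/subsetP=> w /nbhdP[v vS Evw]; rewrite inE.
  have [->|wNw1] := eqVneq w w1.
    apply/orP; right; apply/nbhdP; exists u => //.
    by rewrite !inE xpair_eqE eqxx w12.
  have [->|wNw2] := eqVneq w w2.
    apply/orP; left; apply/nbhdP; exists u => //.
    by rewrite !inE xpair_eqE eqxx eq_sym w12.
  case/setUP: vS => vS; apply/orP; [left|right]; apply/nbhdP; exists v => //;
    by rewrite !inE xpair_eqE negb_and (wNw1, wNw2) ?orbT.
apply/subsetP=> w /nbhdP[v]; rewrite !in_setD1 inE => /and3P[vNu vS1 vS2] Evw.
rewrite in_setI; apply/andP; split; apply/nbhdP; exists v => //;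
  by rewrite !inE xpair_eqE negb_and vNu.
Qed.

(* While some u in U has two neighbours w1 and w2, one of the edges (u, w1),
   (u, w2) can be deleted: otherwise the two violating sets both contain u and
   nbhd_uncross gives a violating set before the deletion.  The point u0 only
   provides a default value for g. *)
Lemma koenig_deficiency (u0 : T1) U E k :
    (forall S, S \subset U -> k + #|S| <= #|U| + #|nbhd E S|) ->
  exists (B : {set T2}) (g : T2 -> T1),
    [/\ k <= #|B|, {in B &, injective g} &
        {in B, forall w, (g w \in U) && ((g w, w) \in E)}].
Proof.
have [m] := ubnP #|E|; elim: m E => // m IH E leEm hall.
have [/existsP[u /andP[uU]] | deg1] :=
  boolP [exists u, (u \in U) &&
    [exists w1, exists w2, [&& w1 != w2, (u, w1) \in E & (u, w2) \in E]]].
  move=> /existsP[w1 /existsP[w2 /and3P[w12 Ew1 Ew2]]].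
  pose ok w := [forall S : {set T1},
    (S \subset U) ==> (k + #|S| <= #|U| + #|nbhd (E :\ (u, w)) S|)].
  have step w : (u, w) \in E -> ok w ->
      exists (B : {set T2}) (g : T2 -> T1),
    [/\ k <= #|B|, {in B &, injective g} &
        {in B, forall w, (g w \in U) && ((g w, w) \in E)}].
    move=> Ew /forallP okw.
    have [||B [g [kB gI gE]]] := IH (E :\ (u, w)).
    - by move: leEm; rewrite (cardsD1 (u, w)) Ew.
    - by move=> S; apply/implyP/okw.
    exists B, g; split=> // x /gE /andP[-> ]; by rewrite inE => /andP[_ ->].
  have bad w : (u, w) \in E -> ~~ ok w -> exists S,
      [/\ S \subset U, u \in S & #|U| + #|nbhd (E :\ (u, w)) S| < k + #|S|].
    move=> Ew /forallPn[S]; rewrite negb_imply -ltnNge => /andP[SU lt].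
    (* If [u] were outside [S], deleting [(u, w)] would leave [nbhd E S] unchanged. *)
    exists S; split=> //; apply: contraTT lt => uNS; rewrite -leqNgt.
    apply: (leq_trans (hall S SU)); rewrite leq_add2l subset_leq_card //.
    apply/subsetP=> x /nbhdP[v vS Evx]; apply/nbhdP; exists v => //.
    rewrite !inE xpair_eqE negb_and Evx andbT.
    by apply/orP; left; apply: contraNneq uNS => <-.
  have [/(step _ Ew1)//|/(bad _ Ew1)[S1 [S1U uS1 lt1]]] := boolP (ok w1).
  have [/(step _ Ew2)//|/(bad _ Ew2)[S2 [S2U uS2 lt2]]] := boolP (ok w2).
  (* The two strict violations give a slack of 2, while discarding [u] from the intersection costs
     only 1. *)
  have := nbhd_uncross w12 Ew1 Ew2 uS1 uS2.
  have := hall (S1 :|: S2); rewrite subUset S1U S2U => /(_ isT).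
  have := hall ((S1 :&: S2) :\ u).
  rewrite (subset_trans (subD1set _ _)) ?(subset_trans (subsetIl _ _)) //.
  move=> /(_ isT); have := cardsUI S1 S2.
  have : #|S1 :&: S2| = (#|(S1 :&: S2) :\ u|).+1.
    by rewrite (cardsD1 u) inE uS1 uS2.
  move: lt1 lt2; set n1 := #|nbhd _ S1|; set n2 := #|nbhd _ S2|.
  by move=> *; exfalso; lia.
(* Each point of [U] now has at most one neighbour, so choosing for each [w] a neighbour in [U] is
   injective on [nbhd E U]. *)
pose g w := odflt u0 [pick u in U | (u, w) \in E].
have gE : {in nbhd E U, forall w, (g w \in U) && ((g w, w) \in E)}.
  move=> w /nbhdP[u uU Euw]; rewrite /g; case: pickP => //= /(_ u).
  by rewrite uU Euw.
exists (nbhd E U), g; split=> //.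
  by have := hall U (subxx _); rewrite addnC leq_add2l.
move=> w1 w2 /gE/andP[gU E1] /gE/andP[_ E2] eqg; apply/eqP.
move: deg1; apply: contraNT => w12; apply/existsP; exists (g w1).
by rewrite gU /=; apply/existsP; exists w1; apply/existsP; exists w2;
   rewrite w12 E1 eqg E2.
Qed.

End Koenig.

Lemma matching_number_ge (G : sgraph) (M : {set {set G}}) :
  matching M -> (#|M| <= matching_number G)%N.
Proof. exact: (@leq_bigmax_cond _ (@matching G) (fun M => #|M|)). Qed.

(** Take [S] minimising [d]. Then [koenig_deficiency] holds with [k = d S], and the pairs
    [[set g w; w]] for [w] in [B] form a matching of at least [d S] edges. *)
Lemma bipartite_koenig (G : sgraph) (U W : {set G}) : bipartition U W ->
  exists2 S : {set G}, S \subset U &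
    (#|U| + #|nbhd [set p : G * G | adj p.1 p.2] S|
       <= matching_number G + #|S|)%N.
Proof.
case=> _ dUW bip; set E := [set p | _].
pose d (S : {set G}) := (#|U| + #|nbhd E S| - #|S|)%N.
have sU0 : set0 \subset U by apply: sub0set.
case: (arg_minnP (P := fun S : {set G} => S \subset U) d sU0) => S SU minS.
(* Hence the truncated subtraction in [d] loses nothing. *)
have le_d (S' : {set G}) : S' \subset U -> (#|S'| <= #|U| + #|nbhd E S'|)%N.
  by move=> /subset_leq_card /leq_trans; apply; apply: leq_addr.
have [x0 _] : {x0 : G | x0 \in G} by apply/sigW/card_gt0P/vertex_gt0.
have [S' S'U|B [g [kB gI gE]]] := @koenig_deficiency G G x0 U E (d S).
  by have := minS _ S'U; have := le_d _ S'U; rewrite /d; lia.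
have {}gE w : w \in B -> [/\ w \in W, g w \notin W & adj (g w) w].
  move=> /gE; rewrite inE /= => /andP[gU gw]; split=> //.
    by case/orP: (bip _ _ gw) => /andP[] // gW _; rewrite (disjointFr dUW gU) in gW.
  by rewrite (disjointFr dUW gU).
pose ed w := [set g w; w].
(* This serves both for the injectivity of [ed] and for the disjointness of its values; an end [g v]
   outside [W] cannot equal an end [w] in [W]. *)
have edI : {in B &, forall v w z, z \in ed v -> z \in ed w -> v = w}.
  move=> v w Bv Bw z; have [vW gvW _] := gE v Bv; have [wW gwW _] := gE w Bw.
  rewrite !inE => /orP[]/eqP-> /orP[]/eqP eq //.
  - exact: gI.
  - by rewrite eq wW in gvW.
  - by rewrite -eq vW in gwW.
exists S => //; suff : (#|B| <= matching_number G)%N.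
  by have := le_d _ SU; move: kB; rewrite /d; lia.
rewrite -(card_in_imset (f := ed)); last first.
  move=> v w Bv Bw eq; apply: (edI v w Bv Bw v); first by rewrite !inE eqxx orbT.
  by rewrite -eq !inE eqxx orbT.
apply: matching_number_ge; apply/andP; split.
  apply/subsetP=> _ /imsetP[w Bw ->]; have [_ _ gw] := gE w Bw.
  by apply/imsetP; exists (g w, w); rewrite ?inE.
apply/trivIsetP=> _ _ /imsetP[v Bv ->] /imsetP[w Bw ->] neq.
rewrite -setI_eq0; apply: contraNT neq => /set0Pn[z /setIP[zv zw]].
by rewrite (edI v w Bv Bw z).
Qed.

Theorem theorem3p6 (R : realType) (beta : R) (G : sgraph) (U W : {set G})
    (n : nat) :
  0 < beta ->
  bipartition U W ->
  (#|W| >= #|U|)%N ->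
  n = (#|U| + #|W|)%N ->
  (forall x : G, ~ isolated x) ->
  nbeta_graph G n beta ->
  (matching_number G)%:R >= Num.min (1 / beta ^+ 2) 1 * #|U|%:R.
Proof.
move=> beta0 bipUW UW nE noiso [cardG G_beta].
have [S SU] := bipartite_koenig bipUW; set T := nbhd _ S => koenig.
have minP : 0 <= Num.min (1 / beta ^+ 2) 1 <= 1.
  by rewrite ge_min lexx orbT andbT le_min ler01 divr_ge0 // exprn_ge0 // ltW.
have [leST | ltTS] := leqP #|S| #|T|.
  have leU : (#|U| <= matching_number G)%N by lia.
  case/andP: minP => min0 min1; apply: (@le_trans _ _ #|U|%:R); last first.
    by rewrite ler_nat.
  by rewrite ler_piMl // ler0n.
(* A nonempty [T] makes [~: T] proper and allows division by its cardinality. *)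
have T_gt0 : (0 < #|T|)%N.
  have /card_gt0P[u uS] : (0 < #|S|)%N by apply: leq_ltn_trans ltTS.
  apply/card_gt0P; have /existsP[w uw] : [exists w, adj u w].
    by apply: contra_notT (noiso u) => /existsPn.
  by exists w; apply/nbhdP; exists u => //; rewrite inE.
have sSU := subset_leq_card SU.
have ltTn : (#|T| < n)%N by lia.
have ltSn : (#|S| < n)%N by lia.
case: G_beta => [complG | /(_ S (~: T))].
  (* [U] is independent, so completeness leaves it at most one vertex, against
     [0 < #|T| < #|S| <= #|U|]. *)
  have : (#|U| <= 1)%N.
    apply/card_le1_eqP => x y xU yU; apply/eqP/negPn/negP => /complG xy.
    case: bipUW => _ dUW /(_ _ _ xy).
    by rewrite !(disjointFr dUW) // andbF.
  by lia.
have cardC : #|~: T| = (n - #|T|)%N by rewrite cardsCs setCK cardG.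
have properS (X : {set G}) : (#|X| < n)%N -> X \proper [set: G].
  by move=> ltX; rewrite properEcard subsetT cardsT cardG.
move=> /(_ (properS _ ltSn)) /(_ (properS _ _)); rewrite cardC.
rewrite ltn_subrL T_gt0 (leq_trans _ ltTn) // => /(_ isT).
have -> : num_edges S (~: T) = 0%N.
  apply/eqP; rewrite cards_eq0; apply/eqP/setP => -[x y]; rewrite !inE /=.
  apply/negP => /and3P[xS /negP nT xy]; apply: nT.
  by apply/exists_inP; exists x => //; rewrite inE.
move=> /(_ erefl); rewrite natrB ?(ltnW ltTn) // subKr => ratio.
move: koenig; rewrite -(ler_nat R) !natrD.
move: ratio; rewrite -(ltr_nat R) in ltTS; rewrite -(ltr_nat R) in T_gt0.
rewrite -(ltr_nat R) in ltTn; rewrite -(ltr_nat R) in ltSn.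
rewrite -(ler_nat R) in sSU.
set s := #|S|%:R; set t := #|T|%:R; set N := n%:R; set u := #|U|%:R.
set nu := (matching_number G)%:R.
rewrite -/s -/t -/N -/u in ltTS T_gt0 ltTn ltSn sSU * => ratio koenig.
have s0 : 0 < s by lra.
have b20 : 0 < beta ^+ 2 by apply: exprn_gt0.
have inv_le : 1 / beta ^+ 2 <= t / s.
  rewrite ler_pdivrMr // mulrAC ler_pdivlMr // mul1r.
  (* The ratio for [S] and [~: T] is [s / t] times [(N - t) / (N - s)], and the second factor
     exceeds 1 because [t < s]. *)
  have : s / t <= beta ^+ 2.
    apply: le_trans ratio; rewrite ler_pdivlMr ?mulr_gt0 ?subr_gt0 //.
    rewrite [_ * t]mulrC mulrA divfK ?gt_eqF // ler_pM2l //; lra.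
  by rewrite ler_pdivrMr // mulrC.
have u0 : 0 <= u by apply: ler0n.
apply: (@le_trans _ _ (t / s * u)).
  by apply: ler_wpM2r => //; rewrite ge_min inv_le.
(* The inequality reduces to [s * (u - s + t) - t * u = (s - t) * (u - s) >= 0]. *)
rewrite mulrAC ler_pdivrMr //; nra.
Qed.
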